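(* Suppose $X$ is a compact Hausdorff space. If $X$ is first countable, then $X$ is an $\eta$-space if and only if $X$ has no isolated points.
   Context: $C(X)$ denotes the algebra of complex-valued continuous functions on $X$. A map $T$ on $C(X)$ is additive if $T(f+g)=T(f)+T(g)$ for all $f,g$; it is a multiplication if there is $a\in C(X)$ with $T(f)=af$ for all $f\in C(X)$; it is a local multiplication if for each $f\in C(X)$ there is $a_f\in C(X)$ with $T(f)=a_f f$. A compact Hausdorff space $X$ is an $\eta$-space if every additive local multiplication on $C(X)$ is a multiplication. *)

(* Defs.v *)
From HB Require Import structures.
From mathcomp Require Import all_boot all_order all_algebra.
From mathcomp Require Export complex.
From mathcomp Require Import all_classical all_reals topology normedtype.

Set Implicit Arguments.
Unset Strict Implicit.
Unset Printing Implicit Defensive.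

Import Order.TTheory GRing.Theory Num.Theory numFieldNormedType.Exports.

Local Open Scope classical_set_scope.
Local Open Scope ring_scope.
Local Open Scope complex_scope.

(* [R[i]] has the topology of its modulus, as every [numFieldType] does through
   its regular module [R[i]^o]. *)
HB.instance Definition _ (R : realType) := NormedModule.copy R[i] R[i]^o.

Notation cfun R X := (continuousType X R[i]).

(* Only a possibly zero ring ([PzRing]), as [X] may be empty. *)
Section cfun_ring.
Context {R : realType} {X : topologicalType}.
Implicit Types f g h : cfun R X.

Let cfun_zero_cts : continuous (fun _ : X => 0 : R[i]).
Proof. by move=> x; exact: cvg_cst. Qed.

Let cfun_one_cts : continuous (fun _ : X => 1 : R[i]).
Proof. by move=> x; exact: cvg_cst. Qed.

Let cfun_opp_cts f : continuous (fun x => - f x).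
Proof. by move=> x; apply: cvgN; exact: cts_fun. Qed.

Let cfun_add_cts f g : continuous (fun x => f x + g x).
Proof. by move=> x; apply: cvgD; exact: cts_fun. Qed.

Let cfun_mul_cts f g : continuous (fun x => f x * g x).
Proof. by move=> x; apply: cvgM; exact: cts_fun. Qed.

Definition cfun_zero : cfun R X := mkcts cfun_zero_cts.
Definition cfun_one : cfun R X := mkcts cfun_one_cts.
Definition cfun_opp f : cfun R X := mkcts (@cfun_opp_cts f).
Definition cfun_add f g : cfun R X := mkcts (@cfun_add_cts f g).
Definition cfun_mul f g : cfun R X := mkcts (@cfun_mul_cts f g).

Let cfun_addA : associative cfun_add.
Proof. by move=> f g h; apply/continuousEP => x; exact: addrA. Qed.

Let cfun_addC : commutative cfun_add.
Proof. by move=> f g; apply/continuousEP => x; exact: addrC. Qed.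

Let cfun_add0 : left_id cfun_zero cfun_add.
Proof. by move=> f; apply/continuousEP => x; exact: add0r. Qed.

Let cfun_addN : left_inverse cfun_zero cfun_opp cfun_add.
Proof. by move=> f; apply/continuousEP => x; exact: addNr. Qed.

HB.instance Definition _ := GRing.isZmodule.Build (cfun R X)
  cfun_addA cfun_addC cfun_add0 cfun_addN.

Let cfun_mulA : associative cfun_mul.
Proof. by move=> f g h; apply/continuousEP => x; exact: mulrA. Qed.

Let cfun_mulC : commutative cfun_mul.
Proof. by move=> f g; apply/continuousEP => x; exact: mulrC. Qed.

Let cfun_mul1 : left_id cfun_one cfun_mul.
Proof. by move=> f; apply/continuousEP => x; exact: mul1r. Qed.

Let cfun_mulDl : left_distributive cfun_mul cfun_add.
Proof. by move=> f g h; apply/continuousEP => x; exact: mulrDl. Qed.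

HB.instance Definition _ := GRing.Zmodule_isComPzRing.Build (cfun R X)
  cfun_mulA cfun_mulC cfun_mul1 cfun_mulDl.

Lemma cfunDE f g x : (f + g) x = f x + g x. Proof. by []. Qed.
Lemma cfunME f g x : (f * g) x = f x * g x. Proof. by []. Qed.

End cfun_ring.

Section eta_space.
Context (R : realType) (X : topologicalType).
Implicit Type T : cfun R X -> cfun R X.

Definition multiplication T := exists a : cfun R X, forall f, T f = a * f.

Definition local_multiplication T := forall f, exists a : cfun R X, T f = a * f.

Definition eta_space := forall T,
  {morph T : f g / f + g} -> local_multiplication T -> multiplication T.

End eta_space.

Definition first_countable (X : topologicalType) := forall x : X,
  exists2 B : set (set X),
    countable B & B `<=` nbhs x /\ filter_from B id --> x.

(* Main.v *)
Require Import Defs.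
From mathcomp Require Import all_boot all_order all_algebra.
From mathcomp Require Import all_classical all_reals topology normedtype.
From mathcomp Require Import sequences numfun.

(** If [p] is an isolated point, the operator that conjugates [f p] and kills
    all other values is additive. It multiplies each [f] by a function carried
    by the clopen singleton of [p], namely by the quotient of the conjugate of
    [f p] by [f p], or by [0] if [f p] is zero. It is not a multiplication, as it
    is not complex linear ([open_point_not_eta_space]).

    Conversely, let [T] be an additive local multiplication. If [T f = a * f],
    the value [T f p] vanishes with [f p], so by additivity it depends on [f p]
    only ([local_multiplication_eq]). It therefore suffices to show
    [T z p = T 1 p * z] for constants [z] and non-isolated points [p]
    ([local_multiplication_cst]). By first countability [p] is the limit of an
    injective sequence [u] avoiding [p], and Tietze's theorem gives a continuous
    [f] with [f (u n) = 1 / (n + 1)] for even [n] and [f (u n) = z / (n + 1)]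
    for odd [n]. Let [T f = a * f]. An additive map commutes with division by
    [n + 1], so [a = T 1] at the even terms and [a * z = T z] at the odd ones
    ([local_multiplier_at_fraction]). Both equations pass to the limit [p],
    where the single value [a p] gives [T 1 p * z = a p * z = T z p]. *)

Set Implicit Arguments.
Unset Strict Implicit.
Unset Printing Implicit Defensive.

Import Order.TTheory GRing.Theory Num.Theory numFieldNormedType.Exports.

Local Open Scope classical_set_scope.
Local Open Scope ring_scope.

(** * Sequences converging to a limit point *)

Lemma nbhs_setC_finite (X : topologicalType) (p : X) (A : set X) :
  accessible_space X -> finite_set A -> ~ A p -> nbhs p (~` A).
Proof.
move=> X_T1 A_fin Ap; apply: open_nbhs_nbhs; split=> //; apply: closed_openC.
exact: (accessible_finite_set_closed.1 X_T1).
Qed.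

(** The finite intersections of an enumerated countable basis shrink to [p]. *)
Lemma first_countable_cvg_seq (X : topologicalType) (p : X) :
  first_countable X -> exists V : nat -> set X, (forall n, nbhs p (V n)) /\
    forall u : nat -> X, (forall n, V n (u n)) -> u @ \oo --> p.
Proof.
move=> /(_ p)[B /pfcard_geP B_countable [Bp pB]].
have pBex U : nbhs p U -> exists2 b, B b & b `<=` U by move=> /pB.
case: B_countable => [B0|[b]].
  by have [b] := pBex _ filterT; rewrite B0.
exists (fun n => \bigcap_(k in `I_n.+1) b k); split=> [n|u Vu U pU].
  elim: n => [|n IHn].
    by rewrite bigcap_mkord big_ord_recr /= big_ord0 setTI; apply/Bp/funS.
  rewrite bigcap_mkord big_ord_recr /= -bigcap_mkord; apply: filterI => //.
  exact/Bp/funS.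
have [b' Bb' b'U] := pBex _ pU.
have [N _ bN] := @surj _ _ _ _ b _ Bb'.
by exists N => // n /= Nn; apply/b'U; rewrite -bN; apply: Vu.
Qed.

(** Each term is chosen outside the finite list of the earlier ones; this is
    possible because a limit point of a T1 space stays one after the removal
    of finitely many points. *)
Lemma limit_point_inj_seq (X : topologicalType) (p : X) :
    accessible_space X -> first_countable X -> limit_point [set: X] p ->
  exists u : nat -> X,
    [/\ injective u, forall n, u n != p & u @ \oo --> p].
Proof.
move=> X_T1 /(first_countable_cvg_seq p)[V [pV V_cvg]] p_lim.
have next (s : seq X) : exists x, [/\ x != p, x \notin s & V (size s) x].
  have pNs : nbhs p (~` ([set` s] `\ p)).
    by apply: nbhs_setC_finite; [|exact: finite_setD|case=> _ /(_ erefl)].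
  have [x [xp _ [xNs Vx]]] := p_lim _ (filterI pNs (pV (size s))).
  by exists x; split=> //; apply/negP => xs; apply: xNs; split=> //; apply/eqP.
have [F FP] := choice next.
(* [S n] lists the first [n] terms, the latest one first. *)
pose S n := iter n (fun s => F s :: s) [::].
have size_S n : size (S n) = n by elim: n => //= n ->.
have F_S m n : (m < n)%N -> F (S m) \in S n.
  elim: n => // n IHn; rewrite ltnS leq_eqVlt => /predU1P[->|/IHn mn] /=.
    exact: mem_head.
  by rewrite inE mn orbT.
exists (fun n => F (S n)); split=> [m n Fmn|n|].
- have FN k : F (S k) \notin S k by case: (FP (S k)).
  by case: (ltngtP m n) => // /F_S; [rewrite Fmn|rewrite -Fmn] => /(negP (FN _)).
- by case: (FP (S n)).
- by apply: V_cvg => n; have [_ _] := FP (S n); rewrite size_S.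
Qed.

Lemma cvg_double : n.*2 @[n --> \oo] --> \oo.
Proof.
move=> A [N _ NA]; exists N => // n /= Nn; apply: NA => /=.
by rewrite (leq_trans Nn) // -addnn leq_addr.
Qed.

Lemma cvg_double_succ : n.*2.+1 @[n --> \oo] --> \oo.
Proof.
move=> A [N _ NA]; exists N => // n /= Nn; apply: NA => /=.
by rewrite (leq_trans Nn) // -addnn -addnS leq_addr.
Qed.

(** * Interpolation along a convergent sequence *)

Section convergent_sequence.
Context {X : topologicalType} (X_hausdorff : hausdorff_space X).
Context (u : nat -> X) (p : X) (u_cvg : u @ \oo --> p).

(** A neighbourhood of [q] disjoint from one of [p] contains finitely many terms
    of the sequence, and those distinct from [q] can be removed. This makes
    the range together with [p] closed, and discrete away from [p]. *)
Lemma nbhs_cvg_seq_trace q :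
  q != p -> \forall x \near q, (range u `|` [set p]) x -> x = q.
Proof.
move=> qp.
have := X_hausdorff; rewrite open_hausdorff => /(_ q p qp).
move=> [[U W] [/= /set_mem qU /set_mem pW] [Uo Wo /eqP/disjoints_subset UW]].
have [N _ uN] := u_cvg (open_nbhs_nbhs (conj Wo pW)).
have qN : nbhs q (~` ([set u n | n in `I_N] `\ q)).
  apply: nbhs_setC_finite; last by case=> _ /(_ erefl).
    exact: hausdorff_accessible.
  exact/finite_setD/finite_image/finite_II.
apply: filterS (filterI (open_nbhs_nbhs (conj Uo qU)) qN) => x [/UW Wx xN].
case=> [[n _ unx]|xp]; last by rewrite xp in Wx.
case: (ltnP n N) => [nN|/uN /=]; last by rewrite unx.
by apply: contrapT => xq; apply: xN; split=> //; exists n.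
Qed.

Lemma closed_cvg_seq : closed (range u `|` [set p]).
Proof.
rewrite -openC openE => q /not_orP[uq /eqP qp].
apply: filterS (nbhs_cvg_seq_trace qp) => x xq /[dup] /xq -> [//|].
exact/eqP.
Qed.

(** Tietze's extension theorem for the function sending [u n] to [t n] and [p]
    to [0], which is continuous on the closed set formed by these points. *)
Lemma continuous_interpolation (R : realType) (t : nat -> R) :
    normal_space X -> injective u -> (forall n, u n != p) ->
    t @ \oo --> (0 : R) ->
  exists2 f : X -> R, continuous f & forall n, f (u n) = t n.
Proof.
move=> X_normal u_inj u_p t_cvg.
(* The default value [0] is the one that [p] needs. *)
pose F x : R := xget 0 [set r | exists2 n, u n = x & t n = r].
have Fu n : F (u n) = t n.
  by apply: xget_unique => [|_ [m /u_inj -> <-]//]; exists n.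
have Fp : F p = 0.
  by apply: xgetPN => r [n unp]; have := u_p n; rewrite unp eqxx.
have [M [_ tM]] := cvg_seq_bounded (cvgP _ t_cvg).
pose M' := Num.max 1 (M + 1).
have tM' n : `|t n| <= M'.
  by apply: tM => //; rewrite lt_max ltrDl ltr01 orbT.
have M'_gt0 : 0 < M' by rewrite lt_max ltr01.
have [||f [Ff f_cts _]] := continuous_bounded_extension (f := F)
  X_normal closed_cvg_seq M'_gt0.
- apply/subspace_continuousP => x _; have [->|xp] := eqVneq x p.
    rewrite /from_subspace Fp; apply/cvgrPdist_lt => e e_gt0.
    have /cvgrPdist_lt/(_ e e_gt0)[N _ tN] := t_cvg.
    have pN : nbhs p (~` [set u n | n in `I_N]).
      apply: nbhs_setC_finite; first exact: hausdorff_accessible.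
        exact/finite_image/finite_II.
      by move=> [n _ unp]; have := u_p n; rewrite unp eqxx.
    apply: filterS pN => y yN [[n _ uny]|->]; last by rewrite Fp subrr normr0.
    rewrite -uny Fu; apply: tN => /=; rewrite leqNgt; apply/negP => nN.
    by apply: yN; exists n.
  apply: cvg_near_cst.
  by apply: filterS (nbhs_cvg_seq_trace xp) => y /[apply] ->.
- by move=> x [[n _ <-]|->]; rewrite ?Fu // Fp normr0 ltW.
exists f => // n; rewrite -Ff ?Fu //; apply/mem_set; left; exact: imageT.
Qed.

End convergent_sequence.

(** * Complex-valued continuous functions *)

Lemma continuous_real_complex (R : realType) :
  continuous (fun r : R => (r%:C)%C : R[i]).
Proof.
move=> r; apply/cvgrPdist_lt => /= e; rewrite ltcE /= => /andP[/eqP e0 e_gt0].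
have /cvgrPdist_lt/(_ _ e_gt0) := @cvg_id _ (nbhs r).
apply: filterS => s rs; rewrite -rmorphB /= normc_def /= expr0n addr0 sqrtr_sqr.
by rewrite ltcE /= -e0 eqxx.
Qed.

Definition cfun_cst (R : realType) (X : topologicalType) (z : R[i]) :
    cfun R X :=
  mkcts (fun x => cvg_cst z : cst z @ x --> cst z x).

Lemma cfun_eq_at_limit (R : realType) (X : topologicalType) (g h : cfun R X)
    (v : nat -> X) (p : X) :
  v @ \oo --> p -> (forall n, g (v n) = h (v n)) -> g p = h p.
Proof.
move=> v_cvg gh.
have vlim (k : cfun R X) : k (v n) @[n --> \oo] --> k p.
  by apply: continuous_cvg v_cvg; exact: cts_fun.
have := vlim g; rewrite (funext gh) => /cvg_unique; apply; last exact: vlim.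
exact: norm_hausdorff.
Qed.

(** * Additive local multiplications *)

Section local_multiplications.
Context (R : realType) (X : topologicalType).
Variable T : cfun R X -> cfun R X.
Hypotheses (T_add : {morph T : f g / f + g}) (T_local : local_multiplication T).

(** [T (f - g)] is a multiple of [f - g], which vanishes at [x]. *)
Lemma local_multiplication_eq (f g : cfun R X) x : f x = g x -> T f x = T g x.
Proof.
move=> fgx; have [a Ta] := T_local (f - g).
rewrite -[f](subrK g) T_add Ta cfunDE cfunME.
have -> : (f - g) x = f x - g x by [].
by rewrite fgx subrr mulr0 add0r.
Qed.

(** Integer multiples are the only scalars an additive map respects: the
    multiplier of [f] at [x] is read off a constant function when [f x] is an
    integral fraction of that constant. *)
Lemma local_multiplier_at_fraction (f a : cfun R X) w x n :
  T f = a * f -> f x *+ n.+1 = w -> a x * w = T (cfun_cst X w) x.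
Proof.
move=> Tf fw.
have T0 : T 0 = 0 by apply: (@addrI _ (T 0)); rewrite -T_add !addr0.
have cfunMnE (g : cfun R X) k : (g *+ k) x = g x *+ k.
  by elim: k => // k IHk; rewrite !mulrS cfunDE IHk.
have TMn k : T (f *+ k) = T f *+ k.
  by elim: k => // k IHk; rewrite !mulrS T_add IHk.
rewrite -(@local_multiplication_eq (f *+ n.+1)) ?cfunMnE //.
by rewrite TMn cfunMnE Tf cfunME -mulrnAr fw.
Qed.

(** The values at [p] of [T] on [1] and on [z] are linked through the single
    multiplier of a function tending to [0] at [p], whose values are fractions
    of [1] and of [z] alternately along a sequence tending to [p]. *)
Lemma local_multiplication_cst p z :
    normal_space X -> hausdorff_space X -> first_countable X ->
    limit_point [set: X] p ->
  T (cfun_cst X z) p = T (cfun_cst X 1) p * z.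
Proof.
move=> X_normal X_hausdorff X_first_countable p_lim.
have [u [u_inj u_p u_cvg]] := limit_point_inj_seq
  (hausdorff_accessible X_hausdorff) X_first_countable p_lim.
have harmonic_part (P : pred nat) :
    exists2 f : X -> R, continuous f & forall n, f (u n) = (P n)%:R * harmonic n.
  apply: (continuous_interpolation X_hausdorff u_cvg) => //.
  apply/norm_cvg0P; apply: (squeeze_cvgr _ (cvg_cst 0) cvg_harmonic).
  near=> n; rewrite normr_ge0 normrM !ger0_norm ?harmonic_ge0 //.
  by rewrite ler_piMl ?lern1 ?leq_b1 // harmonic_ge0.
have complexify (f : X -> R) (f_cts : continuous f) :
    {F : cfun R X | forall x, F x = (f x)%:C%C}.
  unshelve eexists (mkcts (f := fun x => (f x)%:C%C) _); last by [].
  move=> x; apply: continuous_comp; first exact: f_cts.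
  exact: continuous_real_complex.
have [f0 /complexify[F0 F0E] f0u] := harmonic_part (fun n => ~~ odd n).
have [f1 /complexify[F1 F1E] f1u] := harmonic_part odd.
pose F := F0 + cfun_cst X z * F1.
have FE n : F (u n) *+ n.+1 = if odd n then z else 1.
  rewrite /F cfunDE cfunME F0E F1E f0u f1u /=.
  have harmonicMn : ((harmonic n : R)%:C)%C *+ n.+1 = 1.
    by rewrite -rmorphMn /= /harmonic /= -mulr_natr mulVf ?pnatr_eq0 // rmorph1.
  case: (odd n) => /=; rewrite !(mul0r, mul1r) rmorph0 ?mulr0 ?addr0 //.
  by rewrite add0r -mulrnAr harmonicMn mulr1.
have [a TF] := T_local F.
have aE n := local_multiplier_at_fraction TF (FE n).
have u_even : u n.*2 @[n --> \oo] --> p by exact: cvg_comp _ _ cvg_double u_cvg.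
have u_odd : u n.*2.+1 @[n --> \oo] --> p.
  by exact: cvg_comp _ _ cvg_double_succ u_cvg.
have a1 : (a * cfun_cst X 1) p = T (cfun_cst X 1) p.
  apply: (cfun_eq_at_limit u_even) => n.
  by have := aE n.*2; rewrite odd_double.
have az : (a * cfun_cst X z) p = T (cfun_cst X z) p.
  apply: (cfun_eq_at_limit u_odd) => n.
  by have := aE n.*2.+1; rewrite /= odd_double.
by rewrite -az -a1 !cfunME mulr1.
Unshelve. all: by end_near.
Qed.

End local_multiplications.

(** * The operator of an isolated point *)

Section isolated_point.
Context (R : realType) (X : topologicalType) (p : X).
Hypotheses (p_open : open [set p]) (p_closed : closed [set p]).

Lemma continuous_spike (z : R[i]) :
  continuous (fun x => if x == p then z else 0).
Proof.
move=> x; apply: cvg_near_cst; have [->|xp] := eqVneq x p.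
  by apply: filterS (open_nbhs_nbhs (conj p_open erefl)) => y ->; rewrite eqxx.
have xNp : nbhs x (~` [set p]).
  by apply: open_nbhs_nbhs; split; [exact: closed_openC|exact/eqP].
by apply: filterS xNp => y /eqP/negPf ->.
Qed.

Definition spike z : cfun R X := mkcts (continuous_spike (z := z)).

Lemma spikeE z x : spike z x = if x == p then z else 0. Proof. by []. Qed.

(** [f |-> spike (f p)^*] is an additive local multiplication, but as a
    multiplication it would satisfy [z^* = a p * z] for all [z], which fails for
    [z = 'i] once [z = 1] has forced [a p = 1]. *)
Lemma open_point_not_eta_space : ~ eta_space R X.
Proof.
pose T (f : cfun R X) := spike (f p)^*.
have T_add : {morph T : f g / f + g}.
  move=> f g; apply/continuousEP => x; rewrite cfunDE !spikeE cfunDE rmorphD.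
  by case: ifP; rewrite ?addr0.
have T_local : local_multiplication T.
  move=> f; exists (spike ((f p)^* / f p)); apply/continuousEP => x.
  rewrite cfunME !spikeE; case: eqP => [->|_]; last by rewrite mul0r.
  have [->|fp0] := eqVneq (f p) 0; first by rewrite conjC0 mulr0.
  by rewrite divfK.
move=> /(_ T T_add T_local)[a Ta].
have aE z : z^* = a p * z.
  have := congr1 (fun g : cfun R X => g p) (Ta (cfun_cst X z)).
  by rewrite cfunME spikeE eqxx.
have := aE 'i; have := aE 1; rewrite conjC1 mulr1 => <-; rewrite mul1r conjCi.
by move/eqP; rewrite eq_sym -addr_eq0 -mulr2n mulrn_eq0 /= (negPf (neq0Ci _)).
Qed.

End isolated_point.

Theorem corollary2 (R : realType) (X : topologicalType)
    (X_compact : compact [set: X]) (X_hausdorff : hausdorff_space X)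
    (X_first_countable : first_countable X) :
  eta_space R X <-> isolated [set: X] = set0.
Proof.
suff <- : perfect_set [set: X] <-> isolated [set: X] = set0.
  split=> [eta|X_perfect T T_add T_local].
    apply/perfectTP => p p_open; apply: open_point_not_eta_space eta => //.
      exact: p_open.
    exact: (accessible_closed_set1 (hausdorff_accessible X_hausdorff)).
  exists (T 1) => f; apply/continuousEP => x; rewrite cfunME.
  have eqT := local_multiplication_eq T_add T_local.
  rewrite (eqT f (cfun_cst X (f x))) // (eqT 1 (cfun_cst X 1)) //.
  apply: local_multiplication_cst => //; first exact: compact_normal.
  by rewrite X_perfect.2.
by rewrite perfectP; split=> [[]//|]; split.
Qed.
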